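(* Let $1\le p<\infty$. If $\{X_n\}_{n=1}^\infty$ is a nested family of finite-dimensional Banach spaces, then $$D\left(\left(\oplus_{n=1}^\infty X_n\right)_p\right)\le 1^+ .$$
   Context: A family of finite-dimensional Banach spaces $\{X_n\}_{n=1}^\infty$ is nested if $X_n$ is a proper subspace of $X_{n+1}$ (with the norm inherited from $X_{n+1}$) for every $n\in\mathbb{N}$. The space $\left(\oplus_{n=1}^\infty X_n\right)_p$ is the $\ell_p$-direct sum: all sequences $x=\{x_n\}_{n=1}^\infty$ with $x_n\in X_n$ and $\|x\|=\left(\sum_{n=1}^\infty\|x_n\|^p\right)^{1/p}<\infty$. A metric space is locally finite if each ball of finite radius in it has finite cardinality. For $1\le C<\infty$, a map $f:(A,d_A)\to(Y,d_Y)$ between metric spaces is a $C$-bilipschitz embedding if there exists $r>0$ such that $r\,d_A(u,v)\le d_Y(f(u),f(v))\le rC\,d_A(u,v)$ for all $u,v\in A$. A bilipschitz embedding is a map that is $C$-bilipschitz for some such $C$. The distortion of $f$ is the smallest $C$ for which such an $r$ exists. For a Banach space $X$ and a real number $\alpha\ge 1$: (1) $D(X)\le\alpha$ means that, for every $C\in[1,\infty)$ and every locally finite metric space $A$ all of whose finite subsets admit bilipschitz embeddings into $X$ with distortions $\le C$, the space $A$ itself admits a bilipschitz embedding into $X$ with distortion $\le\alpha\cdot C$. (2) $D(X)=\alpha^+$ means that $D(X)\le\alpha+\varepsilon$ holds for every $\varepsilon>0$, while $D(X)\le\alpha$ does not hold. (3) $D(X)\le\alpha^+$ means that $D(X)=\alpha^+$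 or $D(X)\le\alpha$ (equivalently, $D(X)\le\alpha+\varepsilon$ for every $\varepsilon>0$). *)

(* Defs.v *)
From HB Require Import structures.
From mathcomp Require Import all_boot all_order all_algebra.
From mathcomp Require Import all_classical all_reals all_analysis.
From mathcomp Require Import ring lra.

Set Implicit Arguments.
Unset Strict Implicit.
Unset Printing Implicit Defensive.

Import Order.TTheory GRing.Theory Num.Theory.
Import numFieldNormedType.Exports.

Local Open Scope classical_set_scope.
Local Open Scope ring_scope.

Definition finite_dimensional (R : realType) (V : lmodType R) : Prop :=
  exists n : nat, inhabited (Vector.axiom n V).

(* The inclusion of X n in X n.+1 is given as a linear isometry [i]; "proper"
   subspace means that [i] is not onto. *)
Definition nested (R : realType) (X : nat -> completeNormedModType R) : Prop :=
  forall n, exists i : {linear X n -> X n.+1},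
    (forall x, `|i x| = `|x|) /\ (exists y, ~ range i y).

Definition prod_space (R : realType) (X : nat -> completeNormedModType R) :
  Type := forall n, X n.

Section ProdSpace.
Variables (R : realType) (X : nat -> completeNormedModType R).

HB.instance Definition _ := Choice.copy (prod_space X) (forall n, X n).

Implicit Types x y z : prod_space X.

Definition prod_space_zero : prod_space X := fun n => 0.
Definition prod_space_add x y : prod_space X := fun n => x n + y n.
Definition prod_space_opp x : prod_space X := fun n => - x n.
Definition prod_space_scale (a : R) x : prod_space X := fun n => a *: x n.

Lemma prod_space_addA : associative prod_space_add.
Proof.
by move=> x y z; apply: functional_extensionality_dep => n; exact: addrA.
Qed.

Lemma prod_space_addC : commutative prod_space_add.
Proof.
by move=> x y; apply: functional_extensionality_dep => n; exact: addrC.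
Qed.

Lemma prod_space_add0 : left_id prod_space_zero prod_space_add.
Proof.
by move=> x; apply: functional_extensionality_dep => n; exact: add0r.
Qed.

Lemma prod_space_addN :
  left_inverse prod_space_zero prod_space_opp prod_space_add.
Proof.
by move=> x; apply: functional_extensionality_dep => n; exact: addNr.
Qed.

HB.instance Definition _ := GRing.isZmodule.Build (prod_space X)
  prod_space_addA prod_space_addC prod_space_add0 prod_space_addN.

Lemma prod_space_scaleA a b x :
  prod_space_scale a (prod_space_scale b x) = prod_space_scale (a * b) x.
Proof.
by apply: functional_extensionality_dep => n; exact: scalerA.
Qed.

Lemma prod_space_scale1 : left_id 1 prod_space_scale.
Proof.
by move=> x; apply: functional_extensionality_dep => n; exact: scale1r.
Qed.

Lemma prod_space_scaleDr : right_distributive prod_space_scale +%R.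
Proof.
by move=> a x y; apply: functional_extensionality_dep => n; exact: scalerDr.
Qed.

Lemma prod_space_scaleDl x : {morph prod_space_scale^~ x : a b / a + b}.
Proof.
by move=> a b; apply: functional_extensionality_dep => n; exact: scalerDl.
Qed.

HB.instance Definition _ := GRing.Zmodule_isLmodule.Build R (prod_space X)
  prod_space_scaleA prod_space_scale1 prod_space_scaleDr prod_space_scaleDl.

End ProdSpace.

Section LpNorm.
Variables (R : realType) (p : R) (X : nat -> completeNormedModType R).
Implicit Types x y : prod_space X.

Definition lp_enorm x : \bar R :=
  ((\sum_(0 <= n <oo) (`|x n| `^ p)%:E) `^ p^-1)%E.

Definition lp_pred : {pred prod_space X} := fun x => (lp_enorm x < +oo)%E.

Hypothesis p1 : 1 <= p.

Let p0 : 0 < p. Proof. exact: lt_le_trans p1. Qed.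

Lemma lp_enorm_ge0 x : (0 <= lp_enorm x)%E.
Proof. exact: poweR_ge0. Qed.

Lemma lp_enormE x : lp_enorm x = 'N[counting]_p%:E[EFin \o (fun n => `|x n|%R)]%E.
Proof.
rewrite Lnorm_counting// /lp_enorm; congr (_ `^ _)%E; apply: eq_eseriesr => n _.
by rewrite /= normr_id.
Qed.

Lemma lp_enorm_le x y : (forall n, `|x n| <= `|y n|) ->
  (lp_enorm x <= lp_enorm y)%E.
Proof.
move=> xy; apply: gt0_ler_poweR.
- by rewrite invr_ge0 ltW.
- by rewrite in_itv/= nneseries_ge0//= leey.
- by rewrite in_itv/= nneseries_ge0//= leey.
- apply: lee_nneseries => // n _; rewrite lee_fin ge0_ler_powR ?nnegrE//.
  exact: ltW.
Qed.

Lemma lp_enormD x y : (lp_enorm (x + y)%R <= lp_enorm x + lp_enorm y)%E.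
Proof.
rewrite (lp_enormE x) (lp_enormE y).
apply: le_trans (minkowski_EFin _ _ _ p1) => //.
rewrite Lnorm_counting// /lp_enorm; apply: gt0_ler_poweR.
- by rewrite invr_ge0 ltW.
- by rewrite in_itv/= nneseries_ge0//= leey.
- by rewrite in_itv/= nneseries_ge0//= ?leey// => n _ _; exact: poweR_ge0.
apply: lee_nneseries => // n _ /=.
rewrite lee_fin ge0_ler_powR ?nnegrE//; first exact: ltW.
by rewrite [leRHS]ger0_norm ?addr_ge0//; exact: ler_normD.
Qed.

Lemma lp_enormZ (a : R) x : lp_enorm (a *: x) = (`|a|%R%:E * lp_enorm x)%E.
Proof.
rewrite /lp_enorm.
under eq_eseriesr do rewrite normrZ powRM// EFinM.
rewrite nneseriesZl//.
rewrite poweRM ?lee_fin ?powR_ge0 ?nneseries_ge0//.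
by rewrite poweR_EFin -powRrM mulfV ?gt_eqF// powRr1.
Qed.

Lemma lp_enorm0 : lp_enorm 0 = 0%E.
Proof. by rewrite -(scale0r 0) lp_enormZ normr0 mul0e. Qed.

Lemma lp_enorm_ge x n : ((`|x n|%R)%:E <= lp_enorm x)%E.
Proof.
rewrite -[leLHS](_ : ((`|x n| `^ p)%:E `^ p^-1)%E = _); last first.
  by rewrite poweR_EFin -powRrM mulfV ?gt_eqF// powRr1.
apply: gt0_ler_poweR.
- by rewrite invr_ge0 ltW.
- by rewrite in_itv/= lee_fin powR_ge0 leey.
- by rewrite in_itv/= nneseries_ge0//= leey.
apply: le_trans (nneseries_lim_ge n.+1 _) => //.
by rewrite big_nat_recr//= leeDr// sume_ge0.
Qed.

Definition truncate (N : nat) x : prod_space X :=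
  fun n => if (n < N)%N then x n else 0.

Lemma lp_enorm_le_truncate (c : R) x : 0 <= c ->
  (forall N, (lp_enorm (truncate N x) <= c%:E)%E) -> (lp_enorm x <= c%:E)%E.
Proof.
move=> c0 xc.
have rootK : c%:E = ((c `^ p)%:E `^ p^-1)%E.
  by rewrite poweR_EFin -powRrM mulfV ?gt_eqF// powRr1.
rewrite rootK; apply: gt0_ler_poweR.
- by rewrite invr_ge0 ltW.
- by rewrite in_itv/= nneseries_ge0//= leey.
- by rewrite in_itv/= lee_fin powR_ge0 leey.
apply: lime_le.
  by apply: is_cvg_nneseries => n _ _; rewrite lee_fin powR_ge0.
apply: nearW => N.
have TS : (\sum_(0 <= n < N) (`|x n| `^ p)%:E <=
    \sum_(0 <= n <oo) (`|truncate N x n| `^ p)%:E)%E.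
  apply: le_trans (nneseries_lim_ge N _) => //.
  rewrite le_eqVlt; apply/orP; left; apply/eqP; apply: eq_big_nat => n nN.
  by rewrite /truncate (andP nN).2.
apply: le_trans TS _.
have := xc N; rewrite /lp_enorm => /(gt0_ler_poweR (ltW p0)).
rewrite !in_itv/= poweR_ge0 leey lee_fin c0 leey => /(_ isT isT).
rewrite -poweRrM mulVf ?gt_eqF// poweRe1//.
by rewrite nneseries_ge0.
Qed.

Lemma lp_submod_closed : submod_closed lp_pred.
Proof.
split; first by rewrite unfold_in lp_enorm0 ltry.
move=> a x y; rewrite !unfold_in => xoo yoo.
apply: le_lt_trans (lp_enormD _ _) _.
rewrite lp_enormZ lte_add_pinfty// -ge0_fin_numE; last first.
  by rewrite mule_ge0// lp_enorm_ge0.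
by rewrite fin_numM// ge0_fin_numE// lp_enorm_ge0.
Qed.

End LpNorm.

(* The l_p-direct sum. The proof of [1 <= p] is an argument because the norm
   structure depends on it. *)
Definition lp_sum (R : realType) (p : R) (p1 : 1 <= p)
  (X : nat -> completeNormedModType R) : Type :=
  {x : prod_space X | x \in @lp_pred R p X}.

Section LpSum.
Variables (R : realType) (p : R) (p1 : 1 <= p).
Variable X : nat -> completeNormedModType R.

HB.instance Definition _ := SubChoice.on (lp_sum p1 X).
HB.instance Definition _ := GRing.SubChoice_isSubLmodule.Build R (prod_space X)
  (@lp_pred R p X) (lp_sum p1 X) (lp_submod_closed X p1).

Implicit Types x y : lp_sum p1 X.

Definition lp_norm x : R := fine (lp_enorm p (val x)).

Lemma lp_enorm_fin x : lp_enorm p (val x) = (lp_norm x)%:E.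
Proof.
rewrite fineK// ge0_fin_numE ?lp_enorm_ge0//.
exact: (valP x).
Qed.

Lemma lp_normD x y : lp_norm (x + y) <= lp_norm x + lp_norm y.
Proof. by rewrite -lee_fin EFinD -!lp_enorm_fin linearD lp_enormD. Qed.

Lemma lp_normZ (a : R) x : lp_norm (a *: x) = `|a| * lp_norm x.
Proof. by apply: EFin_inj; rewrite EFinM -!lp_enorm_fin linearZ lp_enormZ. Qed.

Lemma lp_norm_ge x n : `|val x n| <= lp_norm x.
Proof. by rewrite -lee_fin -lp_enorm_fin lp_enorm_ge. Qed.

Lemma lp_norm_eq0 x : lp_norm x = 0 -> x = 0.
Proof.
move=> x0; apply: val_inj; apply: functional_extensionality_dep => n.
by apply/eqP; rewrite -normr_le0 -x0 lp_norm_ge.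
Qed.

HB.instance Definition _ := @Lmodule_isNormed.Build R (lp_sum p1 X)
  lp_norm lp_normD lp_normZ lp_norm_eq0.

Lemma lp_normE x :
  `|x| = fine ((\sum_(0 <= n <oo) (`|val x n| `^ p)%:E) `^ p^-1)%E.
Proof. by []. Qed.

Lemma lp_sum_complete (F : set_system (lp_sum p1 X)) :
  ProperFilter F -> cauchy F -> cvg F.
Proof.
move=> FF Fc.
pose vl (z : lp_sum p1 X) : prod_space X := val z.
have Fex e : 0 < e -> exists y : lp_sum p1 X, F (ball y e).
  by move=> e0; have /cauchyP/(_ e e0) := Fc.
have coord_cvg n : cvg ((fun z : lp_sum p1 X => val z n) @ F).
  apply: cauchy_cvg; apply: cauchy_exP => e e0.
  have [y Fy] := Fex e e0; exists (val y n).
  have : F (fun z => ball (val y n) e (val z n)).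
    apply: filterS Fy => z; rewrite -!ball_normE/= => yz.
    exact: le_lt_trans (lp_norm_ge (y - z) n) yz.
  by [].
pose l : prod_space X := fun n => lim ((fun z : lp_sum p1 X => val z n) @ F).
have close (y : lp_sum p1 X) e : 0 < e -> F (ball y e) ->
    (lp_enorm p (vl y - l)%R <= (2 * e)%R%:E)%E.
  move=> e0 Fy; apply: lp_enorm_le_truncate => //; first by rewrite mulr_ge0 ?ltW.
  move=> N.
  have coord_le n : \forall z \near F,
      `|(vl y - l) n| <= 2 * `|(vl y - vl z) n|.
    have [a0|a0] := eqVneq ((vl y - l) n) 0.
      by apply: nearW => z; rewrite a0 normr0 mulr_ge0.
    have : (fun z : lp_sum p1 X => `|(vl y - vl z) n|) @ F -->
        `|(vl y - l) n|.
      apply: cvg_norm; apply: cvgB; first exact: cvg_cst.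
      exact: coord_cvg.
    move=> /cvgr_ge/(_ (`|(vl y - l) n| / 2)) H.
    have : `|(vl y - l) n| / 2 < `|(vl y - l) n|.
      by rewrite ltr_pdivrMr// ltr_pMr ?normr_gt0// ltr1n.
    move=> /H; apply: filterS => z.
    by rewrite ler_pdivrMr// mulrC.
  have all_le : \forall z \near F, forall n, (n < N)%N ->
      `|(vl y - l) n| <= 2 * `|(vl y - vl z) n|.
    elim: N => [|N IH]; first by apply: nearW.
    near=> z => n; rewrite ltnS leq_eqVlt => /predU1P[->|nN].
      by near: z; exact: coord_le.
    by move: n nN; near: z.
  have [z [zN yz]] := filter_ex (filterI all_le Fy).
  have : (lp_enorm p (truncate N (vl y - l)%R) <=
      lp_enorm p (2 *: (vl y - vl z))%R)%E.
    apply: lp_enorm_le => // n; rewrite /truncate; case: ifP => nN; last first.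
      by rewrite normr0.
    by rewrite normrZ ger0_norm// zN.
  move=> /le_trans; apply.
  rewrite lp_enormZ// ger0_norm// EFinM lee_pmul2l// -linearB lp_enorm_fin lee_fin.
  by move: yz; rewrite -ball_normE/= => /ltW.
have [y0 Fy0] := Fex 1 ltr01.
have lP : l \in @lp_pred R p X.
  have -> : l = -1 *: (vl y0 - l) + vl y0 by rewrite scaleN1r opprB subrK.
  apply: (@lp_submod_closed R p X p1).2; last exact: valP.
  by rewrite unfold_in; apply: le_lt_trans (close _ _ ltr01 Fy0) _; rewrite ltry.
pose L : lp_sum p1 X := exist _ l lP.
apply/cvg_ex; exists L; apply/cvg_ballP => e e0.
have e4 : 0 < e / 4 by rewrite divr_gt0.
have [y Fy] := Fex _ e4.
apply: filterS (Fy) => z; rewrite -!ball_normE/= => yz.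
have : `|y - L| <= 2 * (e / 4).
  by rewrite -lee_fin [X in (X <= _)%E](esym (lp_enorm_fin (y - L))) linearB close.
rewrite distrC => Ly.
rewrite -(subrK y L) -addrA; apply: le_lt_trans (ler_normD _ _) _.
rewrite [ltRHS](_ : e = 2 * (e / 4) + 2 * (e / 4)); last by field.
rewrite ler_ltD//; apply: lt_le_trans yz _.
by rewrite ler_peMl ?ltW// ltr1n.
Unshelve. all: by end_near.
Qed.

HB.instance Definition _ :=
  Uniform_isComplete.Build (lp_sum p1 X) lp_sum_complete.

End LpSum.

Section Embeddings.
Variables (R : realType) (A : metricType R) (Y : completeNormedModType R).
Implicit Types (C : R) (S : set A) (f : A -> Y).

(* Maps defined on a subset S of A are represented by total maps on A, of which
   only the restriction to S matters. *)
Definition bilipschitz_with C S f : Prop :=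
  exists2 r : R, 0 < r & forall u v, S u -> S v ->
    r * mdist u v <= `|f u - f v| <= r * C * mdist u v.

Definition bilipschitz S f : Prop := exists2 C, 1 <= C & bilipschitz_with C S f.

Definition distortion S f : R :=
  inf [set C | 1 <= C /\ bilipschitz_with C S f].

(* The infimum is attained: the distortion is the smallest admissible C. *)
Lemma distortion_min S f : bilipschitz S f ->
  [/\ 1 <= distortion S f, bilipschitz_with (distortion S f) S f &
    forall C, 1 <= C -> bilipschitz_with C S f -> distortion S f <= C].
Proof.
move=> [C0 C01 fC0]; set E := [set C | 1 <= C /\ bilipschitz_with C S f].
have EC0 : E C0 by [].
have E0 : E !=set0 by exists C0.
have lbE : has_lbound E by exists 1 => C [].
have D1 : 1 <= distortion S f by apply: lb_le_inf => // C [].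
split => // [|C C1 fC]; last exact: ge_inf.
have [[u [v [Su Sv uv]]]|nuv] := pselect (exists u v, [/\ S u, S v & u <> v]);
    last first.
  exists 1 => // u v Su Sv; have -> : u = v.
    by apply: contrapT => uv; apply: nuv; exists u, v.
  by rewrite mdistxx subrr normr0 !mulr0 lexx.
have duv : 0 < mdist u v by rewrite mdist_gt0; apply/eqP.
pose Q := [set r : R | 0 < r /\
  forall a b, S a -> S b -> r * mdist a b <= `|f a - f b|].
have ubQ : has_ubound Q.
  exists (`|f u - f v| / mdist u v) => r [r0 /(_ u v Su Sv)].
  by rewrite ler_pdivlMr.
have QE C : bilipschitz_with C S f -> exists2 r, Q r &
    forall a b, S a -> S b -> `|f a - f b| <= r * C * mdist a b.
  move=> [r r0 rP]; exists r; last by move=> a b Sa Sb; case/andP: (rP a b Sa Sb).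
  by split=> // a b Sa Sb; case/andP: (rP a b Sa Sb).
have [r0 Qr0 _] := QE _ fC0.
have supQ_gt0 : 0 < sup Q by apply: lt_le_trans Qr0.1 _; exact: ub_le_sup.
exists (sup Q) => // a b Sa Sb.
have [->|/eqP ab] := eqVneq a b.
  by rewrite mdistxx subrr normr0 !mulr0 lexx.
have dab : 0 < mdist a b by rewrite mdist_gt0; apply/eqP.
apply/andP; split.
  rewrite -ler_pdivlMr//; apply: ge_sup; first by exists r0.
  by move=> r [_ /(_ a b Sa Sb)]; rewrite ler_pdivlMr.
rewrite -ler_pdivrMr// [leRHS]mulrC -ler_pdivrMr//; apply: lb_le_inf => // C [C1 fC].
have [r Qr rP] := QE _ fC.
rewrite !ler_pdivrMr//; apply: le_trans (rP a b Sa Sb) _.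
rewrite ler_pM2r// mulrC ler_pM2l; last exact: lt_le_trans C1.
exact: ub_le_sup.
Qed.

Definition embeds_with_distortion_le C S : Prop :=
  exists2 f, bilipschitz S f & distortion S f <= C.

End Embeddings.

Definition locally_finite (R : realType) (A : metricType R) : Prop :=
  forall (x : A) (r : R), finite_set (ball x r).

Section FiniteDetermination.
Variables (R : realType) (Y : completeNormedModType R).

(* D(Y) <= alpha *)
Definition D_le (alpha : R) : Prop :=
  forall (C : R) (A : metricType R), 1 <= C -> locally_finite A ->
    (forall S : set A, finite_set S -> embeds_with_distortion_le Y C S) ->
    embeds_with_distortion_le Y (alpha * C) [set: A].

(* D(Y) = alpha^+ *)
Definition D_eq_plus (alpha : R) : Prop :=
  (forall eps : R, 0 < eps -> D_le (alpha + eps)) /\ ~ D_le alpha.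

(* D(Y) <= alpha^+ *)
Definition D_le_plus (alpha : R) : Prop := D_eq_plus alpha \/ D_le alpha.

End FiniteDetermination.

(* Main.v *)
(* Let Y be the l_p-sum of the X n. As X n embeds isometrically in X m for
   n <= m, a pairing function (k, n) |-> m with n <= m turns a sequence of
   elements of Y into one element of Y, so Y contains an isometric copy of its
   own l_p-sum l_p(Y). It thus suffices to embed A in l_p(Y).

   Fix a base point x0, write |u| = d(x0, u), and let g_k be an embedding of
   distortion at most C of the ball of radius exp((k + 1) / eta), normalized so
   that g_k x0 = 0 and d <= |g_k u - g_k v| <= C d. Let
   a : [0, oo) -> l_p be the broken line through the unit vectors e_0, e_1, ...,
   radially projected to the unit sphere; it is 16-Lipschitz. Map u to
   (a_k(s) g_k u)_k where s = eta ln (1 + |u|). If |v| <= |u|, the difference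
   of the images of u and v is the sum of (a_k(s_u) (g_k u - g_k v))_k, whose
   norm lies between d(u, v) and C d(u, v), and of
   ((a_k(s_u) - a_k(s_v)) g_k v)_k, whose norm is at most
   16 |s_u - s_v| C |v| <= 16 C eta d(u, v). Finally let eta tend to 0. *)

Require Import Defs.
From mathcomp Require Import all_boot all_order all_algebra.
From mathcomp Require Import all_classical all_reals all_analysis.
From mathcomp Require Import ring lra zify.

Set Implicit Arguments.
Unset Strict Implicit.
Unset Printing Implicit Defensive.

Import Order.TTheory GRing.Theory Num.Theory.
Import numFieldNormedType.Exports.
Import PrimeDecompAux.

Local Open Scope classical_set_scope.
Local Open Scope ring_scope.

(** * The pairing of indices and the rearrangement of double series *)

Lemma dyadic_factorization_inj (k l m n : nat) :
  (2 ^ k * m.*2.+1 = 2 ^ l * n.*2.+1)%N -> k = l /\ m = n.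
Proof.
elim: k l => [|k IHk] [|l]; rewrite ?expn0 ?mul1n ?expnS; try lia.
by rewrite -!mulnA => /eqP; rewrite eqn_pmul2l// => /eqP/IHk[-> ->].
Qed.

(* [unpair m = (k, n)] with [m + 1 = 2 ^ k * (2 * n + 1)] *)
Definition unpair (m : nat) : nat * nat := elogn2 0 m m.

Lemma unpairE m : m.+1 = (2 ^ (unpair m).1 * (unpair m).2.*2.+1)%N.
Proof. by rewrite /unpair; case: elogn2P. Qed.

Lemma unpair_inj : injective unpair.
Proof.
by move=> m n mn; apply: succn_inj; rewrite (unpairE m) (unpairE n) mn.
Qed.

Lemma unpair_surj k n : exists m, unpair m = (k, n).
Proof.
exists (2 ^ k * n.*2.+1).-1; set m := _.-1.
have /dyadic_factorization_inj[] :
    (2 ^ (unpair m).1 * (unpair m).2.*2.+1 = 2 ^ k * n.*2.+1)%N.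
  by rewrite -unpairE prednK// muln_gt0 expn_gt0.
by case: (unpair m) => i j /= -> ->.
Qed.

(** Since [m + 1] is a multiple of [2n + 1], one has [n <= m]; hence [X n] embeds in [X m]. *)
Lemma unpair2_le m : ((unpair m).2 <= m)%N.
Proof.
rewrite -ltnS [in ltnRHS]unpairE.
have : (0 < 2 ^ (unpair m).1)%N by rewrite expn_gt0.
nia.
Qed.

(** Sums of nonnegative terms do not depend on the order, and [unpair] is a bijection onto all
    pairs. *)
Lemma nneseries_unpair (R : realType) (a : nat -> nat -> \bar R) :
  (forall k n, 0 <= a k n)%E ->
  (\sum_(0 <= m <oo) a (unpair m).1 (unpair m).2 =
   \sum_(0 <= k <oo) \sum_(0 <= n <oo) a k n)%E.
Proof.
move=> a0; rewrite !nneseries_esumT//; last first.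
  by move=> k; exact: nneseries_ge0.
under [RHS]eq_esum do rewrite nneseries_esumT//.
rewrite esum_esum//.
rewrite (_ : _ `*`` _ = setT); last by apply/seteqP; split.
rewrite (@reindex_esum _ _ _ setT setT unpair (fun x => a x.1 x.2))//.
split => // [x y _ _|[k n] _]; first exact: unpair_inj.
by have [m mE] := unpair_surj k n; exists m.
Qed.

(** * Coordinatewise domination in l_p-sums *)

Section LpDomination.
Variables (R : realType) (p : R) (p1 : 1 <= p).

(** The two families may differ, so that vector-valued sequences can be compared with scalar
    ones. *)
Lemma lp_enorm_dom (X X' : nat -> completeNormedModType R)
    (x : prod_space X) (y : prod_space X') : (forall n, `|x n| <= `|y n|) ->
  (lp_enorm p x <= lp_enorm p y)%E.
Proof.
move=> xy; have p0 : 0 <= p by apply: le_trans p1.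
apply: gt0_ler_poweR.
- by rewrite invr_ge0.
- by rewrite in_itv/= nneseries_ge0//= leey.
- by rewrite in_itv/= nneseries_ge0//= leey.
- by apply: lee_nneseries => // n _; rewrite lee_fin ge0_ler_powR ?nnegrE.
Qed.

Lemma lp_norm_dom (X X' : nat -> completeNormedModType R)
    (x : lp_sum p1 X) (y : lp_sum p1 X') :
  (forall n, `|val x n| <= `|val y n|) -> `|x| <= `|y|.
Proof.
by move=> xy; rewrite -lee_fin -!lp_enorm_fin; exact: lp_enorm_dom.
Qed.

Lemma lp_pred_dom (X X' : nat -> completeNormedModType R)
    (x : prod_space X) (y : lp_sum p1 X') :
  (forall n, `|x n| <= `|val y n|) -> x \in @lp_pred R p X.
Proof.
move=> xy; rewrite unfold_in; apply: le_lt_trans (lp_enorm_dom xy) _.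
exact: (valP y).
Qed.

End LpDomination.

(** * The isometric copy of l_p(Y) in Y *)

Section IteratedSum.
Variables (R : realType) (p : R) (p1 : 1 <= p).

Lemma lp_norm_powR (X : nat -> completeNormedModType R) (x : lp_sum p1 X) :
  (`|x| `^ p)%:E = (\sum_(0 <= n <oo) (`|val x n| `^ p)%:E)%E.
Proof.
have p0 : p != 0 by rewrite gt_eqF// (lt_le_trans ltr01).
rewrite -poweR_EFin -lp_enorm_fin /lp_enorm -poweRrM mulVf// poweRe1//.
by rewrite nneseries_ge0.
Qed.

(** Successive inclusions are composed. The condition [j 0 = 0] serves later to show that images lie
    in the l_p-sum. *)
Lemma nested_incl (X : nat -> completeNormedModType R) : nested X ->
  forall n m, (n <= m)%N -> exists j : X n -> X m,
    j 0 = 0 /\ forall x y, `|j x - j y| = `|x - y|.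
Proof.
move=> nX n; elim=> [|m IHm].
  by rewrite leqn0 => /eqP ->; exists id.
rewrite leq_eqVlt => /orP[/eqP ->|]; first by exists id.
rewrite ltnS => /IHm[j [j0 jd]]; have [i [id _]] := nX m.
exists (i \o j); split=> [|x y] /=; first by rewrite j0 linear0.
by rewrite -linearB id jd.
Qed.

Lemma iterated_lp_sum_isometry (X : nat -> completeNormedModType R) :
  nested X ->
  exists J : lp_sum p1 (fun=> lp_sum p1 X : completeNormedModType R) ->
      lp_sum p1 X,
    forall x y, `|J x - J y| = `|x - y|.
Proof.
move=> nX.
pose Z := lp_sum p1 (fun=> lp_sum p1 X : completeNormedModType R).
pose incl m := cid (nested_incl nX (unpair2_le m)).
pose j m : X (unpair m).2 -> X m := projT1 (incl m).
have j0 m : j m 0 = 0 by rewrite /j; case: (incl m) => ? [].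
have jd m x y : `|j m x - j m y| = `|x - y|.
  by rewrite /j; case: (incl m) => ? [].
pose Jfun (z : Z) : prod_space X :=
  fun m => j m (val (val z (unpair m).1) (unpair m).2).
(* Stated with the extended norm, because membership of [Jfun z] in the l_p-sum is deduced from the
   case [y = 0]. *)
have Jd (x y : Z) : lp_enorm p (Jfun x - Jfun y) = `|x - y|%:E.
  rewrite -lp_enorm_fin /lp_enorm; congr (_ `^ _)%E.
  under [RHS]eq_eseriesr do rewrite lp_norm_powR.
  rewrite -(@nneseries_unpair _
    (fun k n => (`|val (val (x - y) k) n| `^ p)%:E))//.
  apply: eq_eseriesr => m _; congr (_ `^ _)%:E; exact: jd.
have J0 : Jfun 0 = 0 by apply: functional_extensionality_dep => m; exact: j0.
have JP z : Jfun z \in @lp_pred R p X.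
  by rewrite unfold_in -(subr0 (Jfun z)) -J0 Jd ltry.
exists (fun z => exist _ (Jfun z) (JP z)) => x y.
by apply: EFin_inj; rewrite -Jd -lp_enorm_fin.
Qed.

End IteratedSum.

(** * Scalar l_p and its unit vectors *)

Section LpSeq.
Variables (R : realType) (p : R) (p1 : 1 <= p).

Definition lp_seq : completeNormedModType R :=
  lp_sum p1 (fun=> R^o : completeNormedModType R).

Definition coef (x : lp_seq) (n : nat) : R :=
  val (x : lp_sum p1 (fun=> R^o : completeNormedModType R)) n.

Lemma coefD x y n : coef (x + y) n = coef x n + coef y n.
Proof. by []. Qed.

Lemma coefB x y n : coef (x - y) n = coef x n - coef y n.
Proof. by []. Qed.

Lemma coefZ (a : R) x n : coef (a *: x) n = a * coef x n.
Proof. by []. Qed.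

Lemma coef_le x n : `|coef x n| <= `|x|.
Proof. exact: lp_norm_ge. Qed.

Definition lp_unit_fun (k : nat) :
    prod_space (fun=> R^o : completeNormedModType R) :=
  fun n => (n == k)%:R.

Lemma lp_unit_enorm k : lp_enorm p (lp_unit_fun k) = 1%E.
Proof.
have p0 : p != 0 by rewrite gt_eqF// (lt_le_trans ltr01).
rewrite /lp_enorm (@nneseriesD1 _ _ k)//= /lp_unit_fun eqxx normr1 powR1.
rewrite eseries0 ?adde0 ?poweR1e ?poweR_EFin ?powR1// => n _ nk.
by rewrite (negbTE nk) normr0 powR0.
Qed.

Lemma lp_unitP k : lp_unit_fun k \in @lp_pred R p _.
Proof. by rewrite unfold_in lp_unit_enorm ltry. Qed.

Definition lp_unit k : lp_seq := exist _ (lp_unit_fun k) (lp_unitP k).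

Lemma lp_unit_norm k : `|lp_unit k| = 1.
Proof. by apply: EFin_inj; rewrite -lp_enorm_fin lp_unit_enorm. Qed.

Lemma coef_unit k n : coef (lp_unit k) n = (n == k)%:R.
Proof. by []. Qed.

End LpSeq.

(** * Elementary estimates in normed spaces *)

Lemma subr_neq0_or (V : zmodType) (x y : V) :
  x - y != 0 -> (x != 0) || (y != 0).
Proof.
apply: contraNT; rewrite negb_or !negbK => /andP[/eqP-> /eqP->].
by rewrite subrr.
Qed.

(** Source of the splitting into a main term (common weight) and an error term (difference of
    weights). *)
Lemma scaleB_split (R : pzRingType) (V : lmodType R) (a b : R) (x y : V) :
  a *: x - b *: y = a *: (x - y) + (a - b) *: y.
Proof. by rewrite scalerBr scalerBl addrA subrK. Qed.

(** The bound on [v] is asked only where [a != 0]: each [g k] is controlled only on its ball, which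
    contains the points that carry a nonzero weight. *)
Lemma ler_normZ_scaled (R : realType) (V : normedModType R) (a : R^o) (v : V)
    (c : R) :
  0 <= c -> (a != 0 -> `|v| <= c) -> `|a *: v| <= `|c *: a|.
Proof.
move=> c0; rewrite !normrZ (ger0_norm c0) mulrC.
have [->|a0] := eqVneq a 0; first by rewrite normr0 !mulr0.
by move=> /(_ isT) vc; rewrite ler_wpM2r.
Qed.

Lemma ler_scaled_normZ (R : realType) (V : normedModType R) (a : R^o) (v : V)
    (c : R) :
  0 <= c -> (a != 0 -> c <= `|v|) -> `|c *: a| <= `|a *: v|.
Proof.
move=> c0; rewrite !normrZ (ger0_norm c0) mulrC.
have [->|a0] := eqVneq a 0; first by rewrite normr0 !mul0r.
by move=> /(_ isT) vc; rewrite ler_wpM2l.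
Qed.

(** The difference is [(x - y) / |x|] plus [(1 / |x| - 1 / |y|) y], and each term has norm at most
    [|x - y| / |x|]. *)
Lemma normalize_lipschitz (R : realType) (V : normedModType R) (c : R)
    (x y : V) :
  0 < c -> c <= `|x| -> c <= `|y| ->
  `| `|x|^-1 *: x - `|y|^-1 *: y | <= 2 * c^-1 * `|x - y|.
Proof.
move=> c0 cx cy; have x0 := lt_le_trans c0 cx; have y0 := lt_le_trans c0 cy.
have -> : `|x|^-1 *: x - `|y|^-1 *: y =
    `|x|^-1 *: (x - y) + (`|x|^-1 * (`|y| - `|x|) * `|y|^-1) *: y.
  rewrite scalerBr -addrA; congr (_ + _).
  rewrite -!scaleNr -scalerDl; congr (_ *: _).
  by field; rewrite !gt_eqF.
apply: le_trans (ler_normD _ _) _.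
rewrite !normrZ !normfV !normr_id -!mulrA mulVf ?gt_eqF// mulr1.
apply: (@le_trans _ _ (2 * (`|x|^-1 * `|x - y|))).
  rewrite mulrCA -mulrDr ler_pM2l ?invr_gt0// mulr_natl mulr2n lerD2l distrC.
  exact: ler_dist_dist.
by rewrite ler_pM2l// ler_wpM2r// lef_pV2.
Qed.

(** * The Lipschitz path of weights on the unit sphere of l_p *)

Section Hats.
Variables (R : realType) (p : R) (p1 : 1 <= p).
Implicit Types s t : R.

(** Coordinates of the broken line: for [0 <= t <= 1], the point at [s = m + t] is
    [(1 - t) e_m + t e_(m+1)]. *)
Definition hat (s : R) (k : nat) : R := Num.max 0 (1 - `|s - k%:R|).

Lemma hat_ge0 s k : 0 <= hat s k.
Proof. by rewrite /hat le_max lexx. Qed.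

Lemma hat_lipschitz (s t : R) k : `|hat s k - hat t k| <= `|s - t|.
Proof.
rewrite /hat; set x := s - k%:R; set y := t - k%:R.
have -> : s - t = x - y by rewrite /x /y; lra.
have := ler_dist_dist x y.
move: (ler_norm (`|x| - `|y|)) (lerNnormlW (lexx `|(`|x| - `|y|)|)).
rewrite /Num.max; do 2 case: ifP; move=> *; rewrite ler_norml; lra.
Qed.

Lemma hat_neq0 s k : hat s k != 0 -> `|s - k%:R| < 1.
Proof.
rewrite ltNge /hat; apply: contraNN => sk; apply/eqP/max_idPl; lra.
Qed.

Lemma hat_support s k : 0 <= s -> hat s k != 0 ->
  (k == Num.truncn s) || (k == (Num.truncn s).+1).
Proof.
move=> s0 /hat_neq0; rewrite ltr_norml => /andP[].
have /andP[+ +] := truncn_itv s0; set m := Num.truncn s => ms sm sk ks.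
have : k%:R < (m.+2)%:R :> R by move: sm; rewrite -!(natr1 m.+1); lra.
have : m%:R < k.+1%:R :> R by rewrite -(natr1 k); lra.
rewrite !ltr_nat; lia.
Qed.

Lemma hat_truncn s : 0 <= s ->
  hat s (Num.truncn s) + hat s (Num.truncn s).+1 = 1.
Proof.
move=> s0; have /andP[] := truncn_itv s0; rewrite /hat -natr1.
set m := (Num.truncn s)%:R => ms sm.
by rewrite (ger0_norm (x := s - m)) ?(ler0_norm (x := s - _)) /Num.max; try lra;
  do 2 case: ifP => *; lra.
Qed.

Local Notation e := (lp_unit p1).

(* The four indices are those where [hat s] or [hat t] may be nonzero. *)
Lemma hat_diff_le (s t : R) k : 0 <= s -> 0 <= t ->
  `|hat s k - hat t k| <= `|coef (`|s - t| *:
    (e (Num.truncn s) + e (Num.truncn s).+1 +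
     e (Num.truncn t) + e (Num.truncn t).+1)) k|.
Proof.
move=> s0 t0; rewrite coefZ !coefD !coef_unit normrM normr_id.
rewrite [X in _ * X]ger0_norm; last by rewrite !addr_ge0.
have [st0|] := eqVneq (hat s k - hat t k) 0.
  by rewrite st0 normr0 mulr_ge0// !addr_ge0.
move=> st; apply: le_trans (hat_lipschitz s t k) _; rewrite ler_peMr//.
have := subr_neq0_or st.
rewrite -!natrD ler1n.
move=> /orP[/(hat_support s0)|/(hat_support t0)] /orP[]/eqP ->;
  by rewrite eqxx; lia.
Qed.

Lemma hatP s : 0 <= s ->
  (hat s : prod_space (fun=> R^o : completeNormedModType R))
    \in @lp_pred R p _.
Proof.
move=> s0; pose y := e (Num.truncn s) + e (Num.truncn s).+1.
apply: (@lp_pred_dom _ _ p1 _ _ _ y) => k.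
change (`|hat s k| <= `|coef y k|).
rewrite /y coefD !coef_unit ger0_norm ?hat_ge0// [leRHS]ger0_norm ?addr_ge0//.
have [->|/(hat_support s0)] := eqVneq (hat s k) 0; first by rewrite addr_ge0.
have : hat s k <= 1 by rewrite /hat ge_max ler01 /= lerBlDr lerDl.
move=> h1 /orP[]/eqP kE; apply: (le_trans h1);
  by rewrite -kE eqxx -natrD ler1n; lia.
Qed.

(* [insubd] returns its default value 0 on sequences outside l_p; [hatP] rules
   this out for [0 <= s]. *)
Definition hat_seq s : lp_seq p1 := insubd 0 (hat s).

Lemma hat_seqE s k : 0 <= s -> coef (hat_seq s) k = hat s k.
Proof. by move=> s0; rewrite /coef /hat_seq insubdK// hatP. Qed.

(** The constant 4 counts the unit vectors in [hat_diff_le]. *)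
Lemma hat_seq_lipschitz s t : 0 <= s -> 0 <= t ->
  `|hat_seq s - hat_seq t| <= 4 * `|s - t|.
Proof.
move=> s0 t0.
apply: (@le_trans _ _ `|(`|s - t| *:
    (e (Num.truncn s) + e (Num.truncn s).+1 +
     e (Num.truncn t) + e (Num.truncn t).+1))|).
  apply: lp_norm_dom => k; apply: le_trans (hat_diff_le k s0 t0).
  by rewrite -(hat_seqE k s0) -(hat_seqE k t0) -coefB.
rewrite normrZ normr_id mulrC ler_wpM2r//.
rewrite [leRHS](_ : _ = 1 + 1 + 1 + 1 :> R); last by ring.
by do 3 (apply: le_trans (ler_normD _ _) _; rewrite lerD ?lp_unit_norm//).
Qed.

(** Two coordinates add up to 1, and each is at most the norm. *)
Lemma hat_seq_ge s : 0 <= s -> 2^-1 <= `|hat_seq s|.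
Proof.
move=> s0; have hat_le k : hat s k <= `|hat_seq s|.
  by rewrite -(ger0_norm (hat_ge0 s k)) -hat_seqE// coef_le.
have := lerD (hat_le (Num.truncn s)) (hat_le (Num.truncn s).+1).
rewrite hat_truncn//; lra.
Qed.

Definition weight s : lp_seq p1 := `|hat_seq s|^-1 *: hat_seq s.

Lemma weight_norm s : 0 <= s -> `|weight s| = 1.
Proof.
move=> s0; rewrite normrZ normfV normr_id mulVf// gt_eqF//.
by apply: lt_le_trans (hat_seq_ge s0); rewrite invr_gt0.
Qed.

Lemma weight_neq0 s k : 0 <= s -> coef (weight s) k != 0 -> s < k.+1%:R.
Proof.
move=> s0; rewrite coefZ mulf_eq0 negb_or hat_seqE// => /andP[_ /hat_neq0].
by rewrite ltr_norml -natr1 => /andP[_]; rewrite ltrBlDl.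
Qed.

(** Normalizing vectors of norm at least 1/2 costs a factor [2 * 2 = 4], on top of the 4 of
    [hat_seq_lipschitz]. *)
Lemma weight_lipschitz s t : 0 <= s -> 0 <= t ->
  `|weight s - weight t| <= 16 * `|s - t|.
Proof.
move=> s0 t0; have h0 : (0 : R) < 2^-1 by rewrite invr_gt0.
apply: le_trans (normalize_lipschitz h0 (hat_seq_ge s0) (hat_seq_ge t0)) _.
have -> : 16 * `|s - t| = 2 * 2^-1^-1 * (4 * `|s - t|).
  by rewrite invrK; ring.
by rewrite ler_pM2l ?invrK//; exact: hat_seq_lipschitz.
Qed.

End Hats.

(** * Normalized embeddings and the slow growth of the logarithm *)

Lemma normalized_embedding (R : realType) (A : metricType R)
    (Y : completeNormedModType R) (C : R) (S : set A) (x0 : A) :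
  embeds_with_distortion_le Y C S ->
  exists g : A -> Y, g x0 = 0 /\ forall u v, S u -> S v ->
    mdist u v <= `|g u - g v| <= C * mdist u v.
Proof.
move=> [f fb fC]; have [_ [r r0 rP] _] := distortion_min fb.
exists (fun u => r^-1 *: (f u - f x0)); split; first by rewrite subrr scaler0.
move=> u v Su Sv; rewrite -scalerBr opprB addrA subrK normrZ.
rewrite gtr0_norm ?invr_gt0// ler_pdivlMl// ler_pdivrMl//.
have /andP[-> /= /le_trans] := rP u v Su Sv.
by apply; rewrite -mulrA ler_pM2l// ler_wpM2r ?mdist_ge0.
Qed.

(** The difference of logarithms is [ln (1 + (x - y) / (1 + y))], at most [(x - y) / (1 + y)]; the
    factor [y] is absorbed by [1 + y]. In the error term, [y] is the size of the nearer point. *)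
Lemma ln1D_ler_dist (R : realType) (x y : R) : 0 <= y -> y <= x ->
  y * `|ln (1 + x) - ln (1 + y)| <= x - y.
Proof.
move=> y0 yx; have y1 : 0 < 1 + y by lra.
have x1 : 0 < 1 + x by lra.
rewrite ger0_norm ?subr_ge0 ?ler_ln ?posrE ?lerD2l//.
rewrite -ln_div ?posrE//.
have -> : (1 + x) / (1 + y) = 1 + (x - y) / (1 + y) by field; rewrite gt_eqF.
have z0 : 0 <= (x - y) / (1 + y) by rewrite divr_ge0 ?subr_ge0// ltW.
have zle : ln (1 + (x - y) / (1 + y)) <= (x - y) / (1 + y).
  by apply: le_ln1Dx; lra.
apply: le_trans (ler_wpM2l y0 zle) _.
rewrite mulrCA ler_piMr ?subr_ge0// ler_pdivrMr//; lra.
Qed.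

(** * Gluing the embeddings of balls into one map to l_p(Y) *)

Section Gluing.
Variables (R : realType) (p : R) (p1 : 1 <= p) (Y : completeNormedModType R).

Let Z : completeNormedModType R := lp_sum p1 (fun=> Y).

Variables (A : metricType R) (x0 : A) (C eta : R) (g : nat -> A -> Y).
Hypotheses (C0 : 0 <= C) (eta0 : 0 < eta).

Let S k : set A := ball x0 (expR (k.+1%:R / eta)).

Hypothesis g0 : forall k, g k x0 = 0.
Hypothesis gP : forall k u v, S k u -> S k v ->
  mdist u v <= `|g k u - g k v| <= C * mdist u v.

Let s u : R := eta * ln (1 + mdist x0 u).
Let a u : lp_seq p1 := weight p1 (s u).

Let s_ge0 u : 0 <= s u.
Proof. by rewrite mulr_ge0 ?(ltW eta0)// ln_ge0// lerDl mdist_ge0. Qed.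

(** A nonzero weight forces [s u < k + 1], that is [1 + mdist x0 u < exp ((k + 1) / eta)], the
    radius of [S k]. *)
Let weight_ball u v k : coef (a u) k != 0 -> mdist x0 v <= mdist x0 u -> S k v.
Proof.
move=> /weight_neq0 => /(_ (s_ge0 u)) + vu.
rewrite /s mulrC -ltr_pdivlMr// -ltr_expR lnK ?posrE ?ltr_wpDr ?mdist_ge0//.
move=> lt; rewrite /S ballEmdist /=; apply: le_lt_trans lt; lra.
Qed.

Let g_le k u : S k u -> `|g k u| <= C * mdist x0 u.
Proof.
move=> Su; have Sx0 : S k x0 by apply: ballxx; exact: expR_gt0.
by have /andP[_] := gP Su Sx0; rewrite g0 subr0 metric_sym.
Qed.

(** One of the two weights is nonzero, and [v] is no farther from [x0] than either point. This is
    why the error term carries [g k v] rather than [g k u]. *)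
Let weight_diff_ball u v k : mdist x0 v <= mdist x0 u ->
  coef (a u - a v) k != 0 -> S k v.
Proof.
move=> vu; rewrite coefB => /subr_neq0_or /orP[] /weight_ball; exact.
Qed.

Let glue_fun u : prod_space (fun=> Y) := fun k => coef (a u) k *: g k u.

Let glueP u : glue_fun u \in @lp_pred R p _.
Proof.
apply: (@lp_pred_dom _ _ p1 _ _ _ ((C * mdist x0 u) *: a u)) => k.
apply: ler_normZ_scaled => [|au]; first by rewrite mulr_ge0 ?mdist_ge0.
exact/g_le/(weight_ball au).
Qed.

Definition glue u : Z := exist _ (glue_fun u) (glueP u).

Let main_fun u v : prod_space (fun=> Y) :=
  fun k => coef (a u) k *: (g k u - g k v).

Let error_fun u v : prod_space (fun=> Y) :=
  fun k => coef (a u - a v) k *: g k v.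

Section Pair.
Variables (u v : A).
Hypothesis vu : mdist x0 v <= mdist x0 u.

Let main_dom k : `|main_fun u v k| <= `|val ((C * mdist u v) *: a u) k|.
Proof.
apply: ler_normZ_scaled => [|au]; first by rewrite mulr_ge0 ?mdist_ge0.
by have /andP[] := gP (weight_ball au (lexx _)) (weight_ball au vu).
Qed.

Let error_dom k :
  `|error_fun u v k| <= `|val ((C * mdist x0 v) *: (a u - a v)) k|.
Proof.
apply: ler_normZ_scaled => [|auv]; first by rewrite mulr_ge0 ?mdist_ge0.
exact/g_le/(weight_diff_ball vu auv).
Qed.

Let main : Z := exist _ (main_fun u v) (lp_pred_dom main_dom).
Let error : Z := exist _ (error_fun u v) (lp_pred_dom error_dom).

Let glueB : glue u - glue v = main + error.
Proof.
apply: val_inj; apply: functional_extensionality_dep => k.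
exact: scaleB_split.
Qed.

Let main_le : `|main| <= C * mdist u v.
Proof.
apply: le_trans (lp_norm_dom (x := main)
  (y := (C * mdist u v) *: a u) main_dom) _.
by rewrite normrZ weight_norm// mulr1 ger0_norm// mulr_ge0 ?mdist_ge0.
Qed.

(** Coordinatewise, [main] dominates the unit vector [a u] scaled by [mdist u v]. *)
Let main_ge : mdist u v <= `|main|.
Proof.
have -> : mdist u v = `|mdist u v *: a u|.
  by rewrite normrZ weight_norm// mulr1 ger0_norm// mdist_ge0.
apply: lp_norm_dom => k; apply: ler_scaled_normZ => [|au].
  exact: mdist_ge0.
by have /andP[] := gP (weight_ball au (lexx _)) (weight_ball au vu).
Qed.

Let error_le : `|error| <= 16 * C * eta * mdist u v.
Proof.
apply: le_trans (lp_norm_dom (x := error)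
  (y := (C * mdist x0 v) *: (a u - a v)) error_dom) _.
rewrite normrZ ger0_norm ?mulr_ge0 ?mdist_ge0//.
have dO : mdist x0 v * `|s u - s v| <= eta * mdist u v.
  rewrite /s -mulrBr normrM (gtr0_norm eta0) mulrCA ler_pM2l//.
  apply: le_trans (ln1D_ler_dist (mdist_ge0 _ _) vu) _.
  by rewrite lerBlDr addrC [mdist u v]metric_sym; exact: metric_triangle.
have := weight_lipschitz p1 (s_ge0 u) (s_ge0 v).
move=> /(ler_wpM2l (mulr_ge0 C0 (mdist_ge0 x0 v))) /le_trans; apply.
have -> : C * mdist x0 v * (16 * `|s u - s v|) =
  16 * C * (mdist x0 v * `|s u - s v|) by ring.
have -> : 16 * C * eta * mdist u v = 16 * C * (eta * mdist u v) by ring.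
by rewrite ler_wpM2l// mulr_ge0.
Qed.

Lemma glue_bounds : (1 - 16 * C * eta) * mdist u v <= `|glue u - glue v|
  <= (C + 16 * C * eta) * mdist u v.
Proof.
rewrite glueB mulrBl mul1r (mulrDl C); apply/andP; split; last first.
  by apply: le_trans (ler_normD _ _) (lerD main_le error_le).
by apply: le_trans (lerB main_ge error_le) (lerB_normD _ _).
Qed.

End Pair.

End Gluing.

(** * Choice of parameters and conclusion *)

Lemma D_le_of_iterated_lp_sum (R : realType) (p : R) (p1 : 1 <= p)
    (Y : completeNormedModType R) (J : lp_sum p1 (fun=> Y) -> Y) :
  (forall x y, `|J x - J y| = `|x - y|) ->
  forall eps, 0 < eps -> D_le Y (1 + eps).
Proof.
move=> JE eps eps0 C A C1 locA finA.
have C0 : 0 < C by lra.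
have C'1 : 1 <= (1 + eps) * C by nra.
suff [f fP] : exists f : A -> Y, bilipschitz_with ((1 + eps) * C) setT f.
  exists f; first by exists ((1 + eps) * C).
  have fb : bilipschitz setT f by exists ((1 + eps) * C).
  by have [_ _] := distortion_min fb; apply.
have [[x0 _]|noA] := pselect (exists x : A, True); last first.
  exists (fun=> 0); exists 1 => // u; by case: noA; exists u.
(* [tau] solves [(1 - tau) (1 + eps) = 1 + tau], and [eta] makes the error constant [16 * C * eta]
   equal to [tau]. *)
pose tau := eps / (2 + eps); pose eta := tau / (16 * C).
have eps2 : 0 < 2 + eps by lra.
have eta0 : 0 < eta by rewrite !divr_gt0// mulr_gt0.
have etaE : 16 * C * eta = tau by rewrite /eta mulrC divfK// gt_eqF// mulr_gt0.
have /choice[g gP] : forall k : nat, exists g : A -> Y, g x0 = 0 /\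
    forall u v, ball x0 (expR (k.+1%:R / eta)) u ->
      ball x0 (expR (k.+1%:R / eta)) v ->
      mdist u v <= `|g u - g v| <= C * mdist u v.
  by move=> k; apply: normalized_embedding; apply: finA; exact: locA.
pose f := glue p1 (ltW C0) eta0 (fun k => (gP k).1) (fun k => (gP k).2).
have fB u v : (1 - tau) * mdist u v <= `|f u - f v| <= (C + tau) * mdist u v.
  (* The bounds are symmetric in the two points, so the farther one may take the role of [u]. *)
  have [vu|/ltW uv] := leP (mdist x0 v) (mdist x0 u).
    by rewrite -etaE; exact: glue_bounds.
  by rewrite -etaE distrC metric_sym; exact: glue_bounds.
have tauE : 1 - tau = 2 / (2 + eps) by rewrite /tau; field; rewrite gt_eqF.
exists (J \o f); exists (1 - tau); first by rewrite tauE divr_gt0.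
move=> u v _ _; rewrite /= JE; have /andP[-> /= /le_trans] := fB u v; apply.
rewrite ler_wpM2r ?mdist_ge0//.
have tau0 : 0 < tau by rewrite divr_gt0.
have -> : (1 - tau) * ((1 + eps) * C) = C + tau * C.
  by rewrite /tau; field; rewrite gt_eqF.
(* From [1 <= C], the upper constant [C + tau] is at most [C + tau * C]. *)
by rewrite lerD2l ler_peMr// ltW.
Qed.

Theorem theorem1p9 (R : realType) (p : R) (p1 : 1 <= p)
  (X : nat -> completeNormedModType R)
  (finX : forall n, finite_dimensional (X n)) (nestedX : nested X) :
  D_le_plus (lp_sum p1 X) 1.
Proof.
(* If [D_le] fails at 1, then [D_eq_plus] at 1 only asks for the bounds [1 + eps]. *)
have [D1|nD1] := pselect (D_le (lp_sum p1 X) 1); [by right | left; split=> //].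
have [J JE] := iterated_lp_sum_isometry p1 nestedX.
exact: (D_le_of_iterated_lp_sum JE).
Qed.
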